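(* Let $d\ge 2$ and let $X_1,\ldots,X_d$ be independent and identically distributed random variables with distribution function $F$ and density function $f$. For $k=1,\ldots,d$, let $X_{(k)}$ be the $k$-th order statistic of $X_1,\ldots,X_d$. Then for every $(i,j)$ with $1\le i,j\le d$ and $i\ne j$, the pair $(X_{(i)},X_{(j)})$ is positively likelihood ratio dependent, i.e., its joint density function is totally positive of order two.
   Context: The $k$-th order statistic $X_{(k)}$ is the $k$-th smallest of $X_1,\ldots,X_d$. A function $g\colon\overline{\mathbb{R}}^2\to[0,+\infty[$, with $\overline{\mathbb{R}}=[-\infty,\infty]$, is totally positive of order two (TP$_2$) if $g(x',y')g(x,y)\ge g(x',y)g(x,y')$ whenever $x\le x'$ and $y\le y'$. Two random variables $X,Y$ are positively likelihood ratio dependent, written ${\rm PLRD}(X,Y)$, if the density function of $(X,Y)$ is TP$_2$. For $i<j$, the joint density of $(X_{(i)},X_{(j)})$ is taken to be $$h_{i,j}(x_i,x_j)=\frac{d!}{(i-1)!(j-i-1)!(d-j)!}[F(x_i)]^{i-1}[F(x_j)-F(x_i)]^{j-i-1}[1-F(x_j)]^{d-j}f(x_i)f(x_j)$$ if $x_i\le x_j$, and $0$ otherwise, with the convention $0^0=1$. *)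

(* Defs.v *)
From mathcomp Require Export all_boot all_order all_algebra.
From mathcomp Require Export all_classical all_reals all_analysis.
Export Order.TTheory GRing.Theory Num.Theory.
Export numFieldNormedType.Exports.

Set Implicit Arguments.
Unset Strict Implicit.
Unset Printing Implicit Defensive.

Local Open Scope classical_set_scope.
Local Open Scope ring_scope.

Definition TP2 (R : realType) (g : \bar R -> \bar R -> R) : Prop :=
  (forall x y, 0 <= g x y) /\
  (forall x x' y y' : \bar R, (x <= x')%E -> (y <= y')%E ->
     g x' y' * g x y >= g x' y * g x y').

(* Mutual independence: the product rule over every finite subfamily. *)
Definition mutually_independent (R : realType) (disp : measure_display)
    (T : measurableType disp) (P : probability T R) (d : nat)
    (X : 'I_d -> {RV P >-> R}) : Prop :=
  forall (J : {set 'I_d}) (A : 'I_d -> set R),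
    (forall k, measurable (A k)) ->
    P (\bigcap_(k in [set k | k \in J]) (X k @^-1` A k)) =
    (\prod_(k in J) P (X k @^-1` A k))%E.

Definition identically_distributed (R : realType) (disp : measure_display)
    (T : measurableType disp) (P : probability T R) (d : nat)
    (X : 'I_d -> {RV P >-> R}) : Prop :=
  forall (k l : 'I_d) (A : set R), measurable A ->
    distribution P (X k) A = distribution P (X l) A.

(* Total positivity is a condition on the extended plane, so distribution
   functions and densities of real random variables are functions on \bar R. *)
Definition is_distribution_function (R : realType) (disp : measure_display)
    (T : measurableType disp) (P : probability T R) (Y : {RV P >-> R})
    (F : \bar R -> R) : Prop :=
  [/\ forall r : R, (F r%:E)%:E = cdf Y r, F -oo%E = 0 & F +oo%E = 1].

(* The finite nonnegative values of f at -oo and +oo are left arbitrary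
   (0 being the usual choice). *)
Definition is_density (R : realType) (disp : measure_display)
    (T : measurableType disp) (P : probability T R) (Y : {RV P >-> R})
    (f : \bar R -> R) : Prop :=
  [/\ forall x, 0 <= f x,
      measurable_fun [set: R] (fun r : R => f r%:E) &
      forall A : set R, measurable A ->
        distribution P Y A = (\int[lebesgue_measure]_(r in A) (f r%:E)%:E)%E].

Definition is_joint_density (R : realType) (disp : measure_display)
    (T : measurableType disp) (P : probability T R) (Y Z : T -> R)
    (g : \bar R -> \bar R -> R) : Prop :=
  [/\ measurable_fun [set: T] Y /\ measurable_fun [set: T] Z,
      forall x y, 0 <= g x y,
      measurable_fun [set: R * R] (fun u : R * R => g u.1%:E u.2%:E) &
      forall A : set (R * R), measurable A ->
        P ((fun t => (Y t, Z t)) @^-1` A) =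
        (\int[lebesgue_measure \x lebesgue_measure]_(u in A)
            (g u.1%:E u.2%:E)%:E)%E].

(* A density is determined only almost everywhere while TP2 is a pointwise
   condition, so the version g of the joint density is an argument. *)
Definition PLRD (R : realType) (disp : measure_display)
    (T : measurableType disp) (P : probability T R) (Y Z : T -> R)
    (g : \bar R -> \bar R -> R) : Prop :=
  is_joint_density P Y Z g /\ TP2 g.

(* k ranges over 1, ..., d. *)
Definition order_statistic (R : realType) (disp : measure_display)
    (T : measurableType disp) (P : probability T R) (d : nat)
    (X : 'I_d -> {RV P >-> R}) (k : nat) : T -> R :=
  fun t => nth 0 (sort <=%R [seq X l t | l <- enum 'I_d]) k.-1.

(* For 1 <= i < j <= d. *)
Definition order_density (R : realType) (d : nat) (F f : \bar R -> R)
    (i j : nat) (x y : \bar R) : R :=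
  if (x <= y)%E then
    d`!%:R / ((i - 1)`! * (j - i - 1)`! * (d - j)`!)%:R
    * F x ^+ (i - 1) * (F y - F x) ^+ (j - i - 1) * (1 - F y) ^+ (d - j)
    * f x * f y
  else 0.

(* For i > j, the density of the swapped pair with its arguments exchanged. *)
Definition order_pair_density (R : realType) (d : nat) (F f : \bar R -> R)
    (i j : nat) (x y : \bar R) : R :=
  if (i < j)%N then order_density d F f i j x y
  else order_density d F f j i y x.

(* Main.v *)
From HB Require Import structures.
From mathcomp Require Import measurable_realfun measurable_fun_approximation.
From mathcomp Require Import zify ring lra.
Require Import Defs.

(** Outside a null set the values of the sample are distinct, and then exactly
    one choice of indices k, l and of disjoint index sets S0, S1 of cardinality
    i - 1 and j - i - 1 satisfies X_m < X_k on S0, X_k < X_m < X_l on S1 and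
    X_l < X_m elsewhere. Integrating out all the variables but X_k and X_l one
    at a time, each by Fubini's theorem, gives the law of (X_k, X_l) on the
    corresponding event; it does not depend on the choice, and the number of
    choices is the multinomial constant of the density.
    On the domain x <= y, total positivity comes from
    (F y' - F x') (F y - F x) - (F y - F x') (F y' - F x)
    = (F x' - F x) (F y' - F y). *)

Set Implicit Arguments.
Unset Strict Implicit.
Unset Printing Implicit Defensive.

Local Open Scope classical_set_scope.
Local Open Scope ring_scope.

(** * Integration and independence *)

Section density.
Local Open Scope ereal_scope.
Context {R : realType} d (T : measurableType d).
Variables (nu m : {measure set T -> \bar R}) (w : T -> \bar R).
Hypotheses (mw : measurable_fun setT w) (w0 : forall x, 0 <= w x)
  (wfin : forall x, w x \is a fin_num)
  (nuE : forall A, measurable A -> nu A = \int[m]_(x in A) w x).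

Import HBNNSimple.

(** Increasing simple approximations of [g] and monotone convergence on both sides reduce the claim
    to indicators, where it is [nuE]. *)
Lemma ge0_integral_density (g : T -> \bar R) :
  measurable_fun setT g -> (forall x, 0 <= g x) ->
  \int[nu]_x g x = \int[m]_x (g x * w x).
Proof.
move=> mg g0; pose h := nnsfun_approx measurableT mg.
have mh n : measurable_fun setT (EFin \o h n) by exact/measurable_EFinP.
have hg x : (EFin \o h n) x @[n --> \oo] --> g x.
  exact: cvg_nnsfun_approx.
have hnd x : nondecreasing_seq (fun n => (h n x)%:E).
  by move=> a b ab; rewrite lee_fin; exact/lefP/nd_nnsfun_approx.
have -> : \int[nu]_x g x = limn (fun n => \int[nu]_x (h n x)%:E).
  rewrite -monotone_convergence//; last by move=> n x _; rewrite lee_fin.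
  by apply: eq_integral => x _; apply/esym/cvg_lim => //; exact: hg.
have -> : \int[m]_x (g x * w x) = limn (fun n => \int[m]_x ((h n x)%:E * w x)).
  rewrite -monotone_convergence//.
- apply: eq_integral => x _; apply/esym/cvg_lim => //.
  by apply: cvgeZr => //; exact: hg.
- by move=> n; exact: (emeasurable_funM (mh n) mw).
- by move=> n x _; apply: mule_ge0 => //; rewrite lee_fin.
- by move=> x _ a b ab; rewrite lee_wpmul2r//; exact: hnd.
congr (limn _); apply/funext => n.
transitivity (\int[nu]_x
   (\sum_(y \in range (h n)) (y * \1_(h n @^-1` [set y]) x)%:E)).
  by apply: eq_integral => t tE; rewrite /= fimfunE -fsumEFin.
have mi r : measurable_fun setT (fun x => (r * \1_(h n @^-1` [set r]) x)%:E).
  by apply/measurable_EFinP; exact: measurable_funM.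
rewrite ge0_integral_fsum//; last by move=> *; exact: nnfun_muleindic_ge0.
transitivity (\int[m]_x (\sum_(y \in range (h n))
    (y * \1_(h n @^-1` [set y]) x)%:E * w x)); last first.
  apply: eq_integral => x _.
  rewrite -ge0_mule_fsuml => [|y]; last exact: nnfun_muleindic_ge0.
  by rewrite fsumEFin// -(fimfunE _ x).
rewrite ge0_integral_fsum//; last 2 first.
  - by move=> y; exact: (emeasurable_funM (mi y) mw).
  - by move=> y x _; rewrite mule_ge0// nnfun_muleindic_ge0.
apply: eq_fsbigr => r /[!inE] -[x _ xr].
have r0 : (0 <= r)%R by rewrite -xr.
rewrite (eq_integral (fun x => r%:E * (\1_(h n @^-1` [set r]) x)%:E)); last first.
  by move=> ? _; rewrite EFinM.
rewrite ge0_integralZl//; last exact/measurable_EFinP.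
rewrite integral_indic// setIT nuE//.
rewrite [RHS](eq_integral (fun x => r%:E * (w \_ (h n @^-1` [set r])) x)); last first.
  by move=> y _; rewrite EFinM -muleA epatch_indic (muleC (w y)).
rewrite ge0_integralZl//.
- by rewrite -integral_mkcond.
- by apply/(measurable_restrictT _ _).1 => //; exact: measurable_funTS.
- by move=> y _; exact: erestrict_ge0.
Qed.

End density.

Section fubini.
Local Open Scope ereal_scope.
Context {R : realType} d (T : measurableType d) (P : probability T R).

(* On [E], the law of [(Y, V)] is the product of the law of [Y] and that of
   [V], by uniqueness of the product measure. *)
Lemma indep_fubini d1 (T1 : measurableType d1) (E : set T) (Y : {mfun T >-> T1})
    (V : {RV P >-> R}) (rho : {measure set T1 -> \bar R}) (w : T1 -> \bar R) :
  measurable E -> measurable_fun setT w -> (forall y, 0 <= w y) ->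
  (forall y, w y \is a fin_num) ->
  (forall C, measurable C -> P (E `&` Y @^-1` C) = \int[rho]_(y in C) w y) ->
  (forall C A, measurable C -> measurable A ->
    P (E `&` Y @^-1` C `&` V @^-1` A) = P (E `&` Y @^-1` C) * P (V @^-1` A)) ->
  forall D, measurable D ->
    P (E `&` [set t | D (Y t, V t)]) =
    \int[rho]_y (distribution P V (xsection D y) * w y).
Proof.
move=> mE mw w0 wfin hw hind D mD.
(* [kap] and [nu] below are the laws of [Y] and of [(Y, V)] under [P] restricted to [E]; [kap] has
   density [w] with respect to [rho]. *)
pose Q := mrestr P mE.
have mYV : measurable_fun setT (fun t => (Y t, V t)).
  exact/measurable_fun_pair.
pose YV : {mfun T >-> (T1 * _)%type} := HB.pack (fun t => (Y t, V t))
  (isMeasurableFun.Build _ _ _ _ _ mYV).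
pose kap' : {measure set _ -> \bar R} := pushforward Q Y.
pose kap := kap' (measurable_funPT Y).
pose nu' : {measure set _ -> \bar R} := pushforward Q YV.
pose nu := nu' mYV.
have kfin : fin_num_fun kap.
  move=> A mA; rewrite /= /pushforward /Q /mrestr fin_num_measure//.
  by apply: measurableI => //; exact: measurable_funPTI.
pose kapf : {finite_measure set _ -> \bar R} := HB.pack (kap : set _ -> \bar R)
  (Measure.on kap) (Measure_isFinite.Build _ _ _ kap kfin).
have -> : P (E `&` [set t | D (Y t, V t)]) = nu D by rewrite setIC.
rewrite -(@product_measure_unique _ _ _ _ _ kapf (distribution P V))//.
  rewrite /product_measure1 (@ge0_integral_density _ _ _ kapf rho w)//.
  - by move=> C mC; rewrite -hw// setIC.
  - exact: measurable_fun_xsection.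
move=> C A mC mA; rewrite /= /pushforward /Q /mrestr [LHS]/=.
have -> : YV @^-1` (C `*` A) `&` E = E `&` Y @^-1` C `&` V @^-1` A.
  by apply/seteqP; split => t /=; tauto.
by rewrite hind// [E `&` _]setIC.
Qed.
End fubini.

Lemma emeasurable_prod {R : realType} d (T : measurableType d) (I : Type)
    (s : seq I) (p : pred I) (F : I -> T -> \bar R) :
  (forall i, p i -> measurable_fun setT (F i)) ->
  measurable_fun setT (fun x => \prod_(i <- s | p i) F i x)%E.
Proof.
move=> mF; elim: s => [|i s ih].
  by under eq_fun do rewrite big_nil; exact: measurable_cst.
under eq_fun do rewrite big_cons.
by case pi : (p i) => //; apply: emeasurable_funM => //; exact: mF.
Qed.

(** * Law of a pair of independent variables under constraints on the others *)

Section law.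
Local Open Scope ereal_scope.
Context {R : realType} d (T : measurableType d) (P : probability T R) (n : nat).
Variables (X : 'I_n -> {RV P >-> R}) (k l : 'I_n).
Hypotheses (hX : mutually_independent X) (kl : k != l).

Let rest : {pred 'I_n} := fun m => (m != k) && (m != l).
Let W t := (X k t, X l t).
Let mu m := distribution P (X m).

Let mW : measurable_fun setT W. Proof. exact/measurable_fun_pair. Qed.
HB.instance Definition _ := isMeasurableFun.Build _ _ _ _ W mW.

Let measurable_ev (p : {pred 'I_n}) (B : 'I_n -> set (R * R * R)) :
  (forall m, measurable (B m)) ->
  measurable (\bigcap_(m in [set m | p m]) [set t | B m (W t, X m t)]).
Proof.
move=> mB; apply: fin_bigcap_measurable => // m _.
rewrite -[X in measurable X]setTI.
by apply: (@measurable_fun_pair _ _ _ _ _ _ W (X m)).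
Qed.

(** Mutual independence for the family that is [Ck] at [k], [Cl] at [l] and [A] elsewhere. *)
Let indep2 A Ck Cl : measurable Ck -> measurable Cl ->
  (forall m, measurable (A m)) ->
  P (\bigcap_(m in [set m | rest m]) (X m @^-1` A m) `&` X k @^-1` Ck
     `&` X l @^-1` Cl) = mu k Ck * mu l Cl * \prod_(m | rest m) mu m (A m).
Proof.
move=> mCk mCl mA.
pose A' (m : 'I_n) := if m == k then Ck else if m == l then Cl else A m.
have mA' m : measurable (A' m) by rewrite /A'; case: (m == k) => //; case: (m == l).
have := hX [set: 'I_n]%SET mA'.
have -> : \bigcap_(m in [set m | m \in [set: 'I_n]%SET]) (X m @^-1` A' m) =
  \bigcap_(m in [set m | rest m]) (X m @^-1` A m) `&` X k @^-1` Ck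
     `&` X l @^-1` Cl.
  apply/seteqP; split => [t h|t [[h hk] hl] m _ /=].
    split; [split|] => /=.
    - move=> m /andP[mk ml] /=; have /= := h m.
      by rewrite inE /A' (negPf mk) (negPf ml); exact.
    - by have /= := h k; rewrite inE /A' eqxx; exact.
    - by have /= := h l; rewrite inE /A' eq_sym (negPf kl) eqxx; exact.
  rewrite /A'; case: eqP => [->//|/eqP mk]; case: eqP => [->//|/eqP ml].
  by apply: h; rewrite /= /rest mk.
move=> ->; rewrite (bigD1 k)/= ?inE// (bigD1 l)/= ?inE 1?eq_sym//.
rewrite muleA; congr (_ * _ * _).
- by rewrite /A' eqxx.
- by rewrite /A' eq_sym (negPf kl) eqxx.
apply: eq_big => [m|m]; first by rewrite inE.
by rewrite inE /A' => /andP[/negPf -> /negPf ->].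
Qed.

(* The sets [B m] are freed from being independent of the pair one index at a
   time, along [s]. *)
Let law_pair_given (s : seq 'I_n) (B : 'I_n -> set (R * R * R)) C :
  (forall m, measurable (B m)) ->
  (forall m, m \notin s -> exists2 A, measurable A & B m = snd @^-1` A) ->
  measurable C ->
  P (\bigcap_(m in [set m | rest m]) [set t | B m (W t, X m t)] `&` W @^-1` C) =
  \int[mu k \x mu l]_(z in C) \prod_(m | rest m) mu m (xsection (B m) z).
Proof.
elim: s B C => [|n0 s ih] B C mB hB mC.
  (* Base case: no [B m] involves the pair, so [E] is independent of it and [indep_fubini] applies
     with the constant density [c]. *)
  have /choice[A hA] : forall m, exists A, measurable A /\ B m = snd @^-1` A.
    by move=> m; have [A mA BA] := hB m isT; exists A.
  have mA m : measurable (A m) by have [] := hA m.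
  pose c := \prod_(m | rest m) mu m (A m).
  pose E := \bigcap_(m in [set m | rest m]) (X m @^-1` A m).
  have c0 : 0 <= c by apply: prode_ge0.
  have cfin : c \is a fin_num.
    by apply: prode_fin_num => m _; rewrite fin_num_measure.
  have -> : \bigcap_(m in [set m | rest m]) [set t | B m (W t, X m t)] = E.
    by apply: eq_bigcapr => m _; have [_ ->] := hA m.
  have mE : measurable E.
    by apply: fin_bigcap_measurable => // m _; exact: measurable_funPTI.
  have hk D : measurable D -> P (E `&` X k @^-1` D) = mu k D * c.
    move=> mD; have := indep2 mD measurableT mA.
    by rewrite preimage_setT setIT {2}/mu probability_setT mule1.
  rewrite (@indep_fubini _ _ _ P _ _ E (X k) (X l) (mu k) (cst c))//.
  - rewrite ge0_integralZr//; last exact: measurable_fun_xsection.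
    rewrite [RHS](eq_integral (cst c)); last first.
      move=> z _; apply: eq_bigr => m _; have [_ ->] := hA m.
      by rewrite xsection_preimage_snd.
    by rewrite integral_cst// muleC.
  - by move=> D mD; rewrite hk// integral_cst// muleC.
  - move=> D D' mD mD'; rewrite indep2// hk// -/c.
    by rewrite muleAC.
(* If [n0] is [k] or [l], [B n0] is not among the constraints; replacing it by the full set brings
   the family under the induction hypothesis. *)
have [rn0|rn0] := boolP (rest n0); last first.
  pose B' m := if rest m then B m else setT.
  have -> : \bigcap_(m in [set m | rest m]) [set t | B m (W t, X m t)] =
      \bigcap_(m in [set m | rest m]) [set t | B' m (W t, X m t)].
    by apply: eq_bigcapr => m /= rm; rewrite /B' rm.
  rewrite ih//.
  - by apply: eq_integral => z _; apply: eq_bigr => m rm; rewrite /B' rm.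
  - by move=> m; rewrite /B'; case: (rest m).
  - move=> m ms; rewrite /B'; case: ifPn => rm; last by exists setT.
    by apply: hB; rewrite inE (negPf ms) orbF; apply: contraNneq rn0 => <-.
(* [w z] is the conditional probability, given [W = z], of the event [E] that collects the
   constraints other than the one at [n0]. *)
pose w z := \prod_(m | rest m && (m != n0)) mu m (xsection (B m) z).
pose E := \bigcap_(m in [set m | rest m && (m != n0)])
  [set t | B m (W t, X m t)].
have w0 z : 0 <= w z by apply: prode_ge0.
have mw : measurable_fun setT w.
  by apply: emeasurable_prod => m _; exact: measurable_fun_xsection.
(* With the constraint at [n0] replaced by membership of [X n0] in [A], the induction hypothesis
   shows that [X n0] is independent of [W] on [E]. *)
have ihA A D : measurable A -> measurable D ->
    P (E `&` W @^-1` D `&` X n0 @^-1` A) =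
    mu n0 A * \int[mu k \x mu l]_(z in D) w z.
  move=> mA mD; pose B' m := if m == n0 then snd @^-1` A else B m.
  have -> : E `&` W @^-1` D `&` X n0 @^-1` A =
      \bigcap_(m in [set m | rest m]) [set t | B' m (W t, X m t)] `&` W @^-1` D.
    apply/seteqP; split => t.
      move=> [[h hD] hA]; split => // m /= rm; rewrite /B'.
      by case: eqP => [->//|/eqP mn]; apply: h; rewrite /= rm.
    move=> [h hD]; split; [split=> //|].
      by move=> m /andP[rm /negPf mn]; have /= := h m rm; rewrite /B' mn.
    by have /= := h n0 rn0; rewrite /B' eqxx.
  rewrite ih//; last first.
  - move=> m ms; rewrite /B'; case: eqP => [_|/eqP mn]; first by exists A.
    by apply: hB; rewrite inE negb_or mn.
  - move=> m; rewrite /B'; case: eqP => // _.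
    by rewrite -[X in measurable X]setTI; exact: measurable_snd.
  rewrite -ge0_integralZl//; last exact: measurable_funTS.
  apply: eq_integral => z _; rewrite (bigD1 n0)//=; congr (_ * _).
    by rewrite /B' eqxx xsection_preimage_snd.
  by apply: eq_bigr => m /andP[_ /negPf mn]; rewrite /B' mn.
have hw D : measurable D ->
    P (E `&` W @^-1` D) = \int[mu k \x mu l]_(z in D) w z.
  move=> mD; have := ihA _ _ measurableT mD.
  by rewrite preimage_setT setIT /mu probability_setT mul1e.
(* Merging [B n0] and [C] into one set lets a single use of [indep_fubini] integrate out [X n0];
   sections of [D] over points outside [C] are empty. *)
pose D := B n0 `&` fst @^-1` C.
have mD : measurable D.
  apply: measurableI => //.
  by rewrite -[X in measurable X]setTI; exact: measurable_fst.
have -> : \bigcap_(m in [set m | rest m]) [set t | B m (W t, X m t)]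
    `&` W @^-1` C = E `&` [set t | D (W t, X n0 t)].
  apply/seteqP; split => t.
    move=> [h hC]; split; last by split => //; exact: h.
    by move=> m /andP[rm _]; exact: h.
  move=> [h [hB0 hC]]; split => // m /= rm.
  by have [->//|mn] := eqVneq m n0; apply: h; rewrite /= rm.
rewrite (@indep_fubini _ _ _ P _ _ E W (X n0) (mu k \x mu l) w)//.
- rewrite [RHS]integral_mkcond; apply: eq_integral => z _.
  rewrite patchE; case: ifPn => zC.
    rewrite [RHS](bigD1 n0)//=; congr (_ * _); congr (mu n0 _).
    apply/seteqP; split => y; rewrite /xsection /= !inE /D /=; first by case.
    by split => //; exact: set_mem.
  rewrite (_ : xsection D z = set0) ?measure0 ?mul0e//.
  apply/seteqP; split => y //; rewrite /xsection /= !inE /D /= => -[_ hC].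
  by move: zC; rewrite notin_setE.
- exact: measurable_ev.
- by move=> z; apply: prode_fin_num => m _; rewrite fin_num_measure//;
    exact: measurable_xsection.
- by move=> D' A mD' mA; rewrite ihA// hw// muleC.
Qed.

(** Putting every index in [s] makes the condition on indices outside [s] vacuous. The product is
    the conditional probability of the constraints given [(X k, X l) = z]. *)
Lemma law_pair (B : 'I_n -> set (R * R * R)) (C : set (R * R)) :
  (forall m, measurable (B m)) -> measurable C ->
  P (\bigcap_(m in [set m | (m != k) && (m != l)])
       [set t | B m (X k t, X l t, X m t)] `&` [set t | C (X k t, X l t)]) =
  \int[distribution P (X k) \x distribution P (X l)]_(z in C)
     \prod_(m | (m != k) && (m != l)) distribution P (X m) (xsection (B m) z).
Proof.
move=> mB mC; apply: (law_pair_given (s := enum 'I_n)) => // m.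
by rewrite mem_enum.
Qed.

End law.

(** * Lebesgue measure on the line and on the plane *)

Section leb.
Local Open Scope ereal_scope.
Context {R : realType}.

Let idR : measurableTypeR R -> R := fun x => x.

Let measurable_idR : measurable_fun setT idR.
Proof. by move=> _ Y mY; rewrite setTI; exact: mY. Qed.

(* [lebesgue_measure] is a measure on [measurableTypeR R], which has the same
   measurable sets as [R] but another display; [lebR] lives on [R] itself. *)
Definition lebR := pushforward (@lebesgue_measure R) idR.

HB.instance Definition _ := isMeasure.Build _ _ _ lebR
  (@measure0 _ _ _ (@lebesgue_measure R)) (measure_ge0 (@lebesgue_measure R))
  (@measure_semi_sigma_additive _ _ _ (@lebesgue_measure R)).

Let lebR_sigma_finite : sigma_finite setT lebR.
Proof.
have [F FT hF] := sigma_finiteT (@lebesgue_measure R).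
exists F => // i; have [mF Foo] := hF i; split => //.
Qed.

HB.instance Definition _ :=
  Measure_isSigmaFinite.Build _ _ _ lebR lebR_sigma_finite.

Lemma ge0_integral_lebR D (f : R -> \bar R) : measurable D ->
  measurable_fun D f -> (forall x, D x -> 0 <= f x) ->
  \int[lebesgue_measure]_(x in D) f x = \int[lebR]_(x in D) f x.
Proof.
move=> mD mf f0; rewrite [RHS]ge0_integral_pushforward//.
by move=> x /set_mem; exact: f0.
Qed.

Let idR2 : measurableTypeR R * measurableTypeR R -> R * R := fun x => x.

Let measurable_idR2 : measurable_fun setT idR2.
Proof.
have -> : idR2 = (fun x => ((idR \o fst) x, (idR \o snd) x)).
  by apply/funext => -[].
apply: measurable_fun_pair.
  by apply: (measurableT_comp measurable_idR); exact: measurable_fst.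
by apply: (measurableT_comp measurable_idR); exact: measurable_snd.
Qed.

(** The image of the product measure under the identity agrees with [lebR \x lebR] on rectangles,
    hence everywhere, by uniqueness of the product measure. *)
Lemma ge0_integral_lebR2 D (f : R * R -> \bar R) : measurable D ->
  measurable_fun D f -> (forall x, D x -> 0 <= f x) ->
  \int[lebesgue_measure \x lebesgue_measure]_(x in D) f x =
  \int[lebR \x lebR]_(x in D) f x.
Proof.
move=> mD mf f0.
pose nu' : {measure set _ -> \bar R} :=
  pushforward (@lebesgue_measure R \x @lebesgue_measure R) idR2.
pose nu := nu' measurable_idR2.
rewrite [RHS](eq_measure_integral nu).
  rewrite [RHS]ge0_integral_pushforward//.
  by move=> x /set_mem; exact: f0.
move=> A mA AD.
apply: (@product_measure_unique _ _ _ _ _ lebR lebR nu) => // B C mB mC.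
by rewrite /= /pushforward product_measure1E.
Qed.
End leb.

(** * Laws with a density *)

Section single.
Context {R : realType} d (T : measurableType d) (P : probability T R).
Variables (Y : {RV P >-> R}) (F f : \bar R -> R).
Hypotheses (hF : is_distribution_function Y F) (hf : is_density Y f).

Lemma distribution_function_le : {homo F : x y / (x <= y)%E >-> x <= y}.
Proof.
have [Fr FNy Fy] := hF.
have F0 x : 0 <= F x.
  case: x => [r| |]; rewrite ?FNy ?Fy//.
  by rewrite -lee_fin Fr; exact: cdf_ge0.
have F1 x : F x <= 1.
  case: x => [r| |]; rewrite ?FNy ?Fy//.
  by rewrite -lee_fin Fr; exact: cdf_le1.
case=> [r| |] [s| |] //=; rewrite ?FNy ?Fy// lee_fin => rs.
by rewrite -lee_fin !Fr; exact: cdf_nondecreasing.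
Qed.

Lemma distribution_function_ge0 x : 0 <= F x.
Proof. by have [_ <- _] := hF; exact/distribution_function_le/leNye. Qed.

Lemma distribution_function_le1 x : F x <= 1.
Proof. by have [_ _ <-] := hF; exact/distribution_function_le/leey. Qed.

Lemma measurable_distribution_function :
  measurable_fun setT (fun r : R => F r%:E).
Proof.
have [Fr _ _] := hF; apply/measurable_EFinP.
by apply: eq_measurable_fun (cdf_measurable Y) => r _ /=; rewrite Fr.
Qed.

Lemma distribution_set1 (x : R) : distribution P Y [set x] = 0%E.
Proof. by have [_ _ fE] := hf; rewrite fE//; exact: (@integral_Sset1 _ _ _ x). Qed.

(** [cdf] measures the closed half-line; its endpoint is null because the law has a density. *)
Lemma distribution_lt (x : R) : distribution P Y [set u | u < x] = (F x%:E)%:E.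
Proof.
have [-> _ _] := hF; rewrite /cdf.
have -> : `]-oo, x]%classic = [set u | u < x] `|` [set x].
  by rewrite -set_itvNyo setUitv1.
rewrite measureU//=.
- by rewrite [X in (_ + X)%E]distribution_set1 adde0.
- by rewrite -set_itvNyo.
- by apply/seteqP; split => // u /= [ux /esym]; apply/eqP; rewrite gt_eqF.
Qed.

Lemma distribution_gt (x : R) :
  distribution P Y [set u | x < u] = (1 - F x%:E)%:E.
Proof.
have [Fr _ _] := hF.
rewrite EFinB -(ccdf_cdf_1 Y x) -Fr addeK//.
by rewrite /ccdf set_itvoy.
Qed.

Lemma distribution_between (x y : R) : x < y ->
  distribution P Y [set u | x < u < y] = (F y%:E - F x%:E)%:E.
Proof.
move=> xy; have [Fr _ _] := hF.
have := distribution_lt y.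
have -> : [set u | u < y] = `]-oo, x]%classic `|` [set u | x < u < y].
  apply/seteqP; split => u /=; rewrite in_itv/=.
    by move=> uy; case: (leP u x) => ux; [left|right].
  by case=> [ux|/andP[]//]; exact: le_lt_trans xy.
rewrite measureU//=; last 2 first.
- by rewrite -set_itvoo.
- apply/seteqP; split => // u /=; rewrite in_itv/= => -[ux /andP[]].
  by rewrite ltNge ux.
rewrite -/(cdf Y x) -Fr EFinB => <-.
by rewrite [LHS]/= addeAC subee// add0e.
Qed.

End single.

Section pair.
Local Open Scope ereal_scope.
Context {R : realType} d (T : measurableType d) (P : probability T R).
Variables (Y Z : {RV P >-> R}) (f : \bar R -> R).
Hypotheses (hY : is_density Y f) (hZ : is_density Z f).

Let ff (z : R * R) := (f z.1%:E * f z.2%:E)%:E.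

Let mf : measurable_fun setT (fun r : R => f r%:E). Proof. by case: hY. Qed.

Let f0 x : (0 <= f x)%R. Proof. by case: hY. Qed.

Let mff : measurable_fun setT ff.
Proof.
apply/measurable_EFinP; apply: measurable_funM.
  by apply: (measurableT_comp mf); exact: measurable_fst.
by apply: (measurableT_comp mf); exact: measurable_snd.
Qed.

Let ff0 z : 0 <= ff z. Proof. by rewrite lee_fin mulr_ge0. Qed.

Let lawE (V : {RV P >-> R}) A : is_density V f -> measurable A ->
  distribution P V A = \int[lebR]_(x in A) (f x%:E)%:E.
Proof.
move=> [_ _ VE] mA; rewrite VE// ge0_integral_lebR//.
  by apply/measurable_EFinP; exact: measurable_funTS.
by move=> x _; rewrite lee_fin.
Qed.

(** The density of [Z] evaluates the law of each section, that of [Y] the outer integral, and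
    Tonelli's theorem reassembles the two. *)
Lemma product_distribution_density C : measurable C ->
  (distribution P Y \x distribution P Z) C =
  \int[lebR \x lebR]_(z in C) (f z.1%:E * f z.2%:E)%:E.
Proof.
move=> mC.
transitivity (\int[distribution P Y]_x (distribution P Z \o xsection C) x) => //.
have mffC : measurable_fun setT (ff \_ C).
  by apply/(measurable_restrictT _ _).1 => //; exact: measurable_funTS.
rewrite (@ge0_integral_density R _ _ (distribution P Y) lebR
  (fun x : R => (f x%:E)%:E))//.
- rewrite [RHS]integral_mkcond fubini_tonelli1//; last first.
    by move=> z; apply: erestrict_ge0 => y _; exact: ff0.
  apply: eq_integral => x _; rewrite /fubini_F /=.
  rewrite (lawE hZ); last exact: measurable_xsection.
  rewrite -ge0_integralZr//; last 4 first.
  + exact: measurable_xsection.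
  + by apply/measurable_EFinP; exact: measurable_funTS.
  + by move=> y _; rewrite lee_fin.
  + by rewrite lee_fin.
  rewrite integral_mkcond; apply: eq_integral => y _.
  by rewrite !patchE mem_xsection; case: ifP => // _; rewrite muleC.
- exact/measurable_EFinP.
- by move=> x; rewrite lee_fin.
- by move=> A mA; exact: lawE.
- exact: measurable_fun_xsection.
Qed.

(** Here integrals against laws become Lebesgue integrals: [G], extended by 0 outside [C], is
    integrated against the product measure, which has density [ff]. *)
Lemma ge0_integral_pair_density C (G : R * R -> R) :
  measurable C -> measurable_fun setT G -> (forall z, C z -> (0 <= G z)%R) ->
  \int[distribution P Y \x distribution P Z]_(z in C) (G z)%:E =
  \int[lebR \x lebR]_(z in C) (G z * f z.1%:E * f z.2%:E)%:E.
Proof.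
move=> mC mG G0; rewrite integral_mkcond.
rewrite (@ge0_integral_density _ _ _
  (distribution P Y \x distribution P Z) (lebR \x lebR) ff)//.
- rewrite [RHS]integral_mkcond; apply: eq_integral => z _.
  by rewrite !patchE; case: ifP => _; rewrite ?mul0e// -mulrA EFinM.
- exact: product_distribution_density.
- apply/(measurable_restrictT _ _).1 => //.
  by apply/measurable_EFinP; exact: measurable_funTS.
- by move=> z; apply: erestrict_ge0 => y Cy; rewrite lee_fin G0.
Qed.

(** Sections of the diagonal are points, null for the law of [Z]. This makes ties in the sample
    negligible. *)
Lemma product_distribution_diag :
  (distribution P Y \x distribution P Z) [set z | z.1 = z.2] = 0.
Proof.
rewrite /product_measure1 integral0_eq// => x _ /=.
rewrite (_ : xsection _ _ = [set x]) ?(distribution_set1 hZ)//.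
by apply/seteqP; split => y; rewrite /xsection/= inE /= => ->.
Qed.

End pair.

(** Reconciles the density, supported on [x <= y], with the law, computed on [x < y]. *)
Lemma lebR2_diag {R : realType} :
  ((lebR \x lebR) [set z : R * R | z.1 = z.2])%E = 0%E.
Proof.
rewrite /product_measure1 integral0_eq// => x _ /=.
rewrite (_ : xsection _ _ = [set x]); first exact: lebesgue_measure_set1.
by apply/seteqP; split => y; rewrite /xsection/= inE /= => ->.
Qed.

Lemma measurable_pred {d} {T : measurableType d} (p : T -> bool) :
  measurable_fun setT p -> measurable [set x | p x].
Proof.
by move=> /(_ measurableT [set true] I); rewrite setTI.
Qed.

Lemma measurable_diag {R : realType} : measurable [set z : R * R | z.1 = z.2].
Proof.
have := measurable_pred (@measurable_fun_eqr _ (R * R)%type R setT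
  fst snd measurable_fst measurable_snd).
by congr (measurable _); apply/seteqP; split => z /= /eqP.
Qed.

(** * Order statistics of finitely many reals *)

Section sorted_values.
Context {R : realDomainType} (d : nat).
Implicit Types (x : 'I_d -> R) (i : nat).

Definition sorted_values x := sort <=%R [seq x l | l <- enum 'I_d].

Lemma size_sorted_values x : size (sorted_values x) = d.
Proof. by rewrite size_sort size_map size_enum_ord. Qed.

Lemma sorted_sorted_values x : sorted <=%O (sorted_values x).
Proof. exact: sort_le_sorted. Qed.

Lemma count_sorted_values (p : pred R) x :
  count p (sorted_values x) = #|[set m | p (x m)]%SET|.
Proof.
rewrite count_sort count_map cardE size_filter -enumT.
by apply: eq_count => m /=; rewrite inE.
Qed.

(** A sorted sequence has value [v] at rank [i] once at most [i] entries are below [v] and more than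
    [i] are at most [v]; the index [k] makes the second count exceed the first. *)
Lemma nth_sorted_values x i k :
  #|[set m | x m < x k]%SET| = i -> nth 0 (sorted_values x) i = x k.
Proof.
move=> hi; apply: nth_count_eq; first exact: sorted_sorted_values.
rewrite !count_sorted_values /= hi leqnn/= -hi.
apply: proper_card; apply/properP; split.
  by apply/fintype.subsetP => m; rewrite !inE; exact: ltW.
by exists k; rewrite !inE ?ltxx.
Qed.

(** Without ties the sorted sequence is strictly increasing, so exactly [i] entries lie below the
    one of rank [i]. *)
Lemma nth_sorted_values_inj x i : injective x -> (i < d)%N ->
  exists2 k, nth 0 (sorted_values x) i = x k & #|[set m | x m < x k]%SET| = i.
Proof.
move=> xinj id.
have : nth 0 (sorted_values x) i \in sorted_values x.
  by rewrite mem_nth// size_sorted_values.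
rewrite mem_sort => /mapP[k _ hk]; exists k => //.
rewrite -(count_sorted_values (fun y => y < x k)) -hk; apply: count_lt_nth.
  rewrite lt_sorted_uniq_le sorted_sorted_values andbT sort_uniq.
  by rewrite map_inj_uniq// enum_uniq.
by rewrite size_sorted_values.
Qed.

(** Valid with ties too; expressing sublevel events through counts is what makes order statistics
    measurable. *)
Lemma nth_sorted_values_lt x i r : (i < d)%N ->
  (nth 0 (sorted_values x) i < r) = (i < #|[set m | (x m < r)%R]%SET|)%N.
Proof.
move=> id; have ss := sorted_sorted_values x.
rewrite -(count_sorted_values (fun y => y < r)).
apply/idP/idP => [|h]; last exact: nth_count_lt.
rewrite ltNge; apply: contraNT; rewrite -leqNgt => h.
by apply: nth_count_ge => //; rewrite h size_sorted_values.
Qed.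

End sorted_values.

(** * Measurability of the order statistics *)

Section measurability.
Context {R : realType} disp (T : measurableType disp) (P : probability T R).
Context (d : nat) (X : 'I_d -> {RV P >-> R}).

(** The statistic is below [r] exactly when, for some set [S] of at least [i] indices, all [X m]
    with [m] in [S] are below [r]: a finite union of finite intersections. *)
Lemma measurable_order_statistic i : (0 < i <= d)%N ->
  measurable_fun setT (order_statistic X i).
Proof.
move=> /andP[i0 id] mT; apply: (measurability _ (RGenInftyO.measurableE R)) => //.
move=> _ [_ [r ->] <-]; rewrite setTI.
have -> : order_statistic X i @^-1` `]-oo, r[ =
  \bigcup_(S in [set S : {set 'I_d} | (i <= #|S|)%N])
   \bigcap_(m in [set m | m \in S]) (X m @^-1` `]-oo, r[).
  (* The 0-based rank is [i.-1], and [i.-1 < n] reads [i <= n] because [0 < i]. *)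
  have hE t : (order_statistic X i t < r) =
      (i <= #|[set m | (X m t < r)%R]%SET|)%N.
    by rewrite nth_sorted_values_lt ?prednK.
  apply/seteqP; split => t /=; rewrite in_itv/= hE.
    move=> hS; exists [set m | (X m t < r)%R]%SET => // m /=.
    by rewrite inE in_itv.
  move=> [S /= iS hS]; apply: (leq_trans iS); apply: subset_leq_card.
  by apply/fintype.subsetP => m mS; rewrite inE; have := hS m mS; rewrite /= in_itv.
apply: fin_bigcup_measurable => // S _; apply: fin_bigcap_measurable => // m _.
exact: measurable_funPTI.
Qed.
End measurability.

(* [(k, l, S0, S1)] stands for: [x k] and [x l] are the order statistics of
   (0-based) ranks [a] and [a + b + 1], the values below [x k] are indexed by
   [S0] and those strictly between [x k] and [x l] by [S1]. *)
Definition config d := ('I_d * 'I_d * {set 'I_d} * {set 'I_d})%type.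

Definition is_config d (a b : nat) (q : config d) : bool :=
  let: (k, l, S0, S1) := q in
  [&& k != l, (S0 \subset ~: [set k; l])%SET && (#|S0| == a)
    & (S1 \subset ~: (k |: (l |: S0)))%SET && (#|S1| == b)].

(** Choose [k], then [l], then [S0] among [d - 2] indices and [S1] among the [d - 2 - a] left; the
    factorials cancel the denominators of the binomials. The product form avoids division. *)
Lemma card_config d a b : (a + b + 2 <= d)%N ->
  (#|[set q : config d | is_config a b q]%SET|
    * (a`! * b`! * (d - (a + b + 2))`!) = d`!)%N.
Proof.
move=> abd.
have -> : #|[set q : config d | is_config a b q]%SET| =
    (d * (d.-1 * ('C(d - 2, a) * 'C(d - 2 - a, b))))%N.
  transitivity (\sum_(k < d) \sum_(l < d | k != l)
    \sum_(S0 : {set 'I_d} | (S0 \subset ~: [set k; l])%SET && (#|S0| == a))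
    \sum_(S1 : {set 'I_d} |
      (S1 \subset ~: (k |: (l |: S0)))%SET && (#|S1| == b)) 1)%N.
    rewrite pair_big_dep/= pair_big_dep/= pair_big_dep/= sum1_card.
    by apply: eq_card => -[[[k l] S0] S1]; rewrite inE unfold_in /= andbA.
  have cardC2 (k l : 'I_d) : k != l -> #|~: [set k; l]%SET| = (d - 2)%N.
    by move=> kl; rewrite cardsCs finset.setCK cards2 kl card_ord.
  have cardC3 (k l : 'I_d) (S0 : {set 'I_d}) : k != l ->
      (S0 \subset ~: [set k; l])%SET -> #|S0| = a ->
      #|~: (k |: (l |: S0))%SET| = (d - 2 - a)%N.
    move=> kl /fintype.subsetP sS0 S0a.
    have kS0 : k \notin S0 by apply/negP => /sS0; rewrite !inE eqxx.
    have lS0 : l \notin S0 by apply/negP => /sS0; rewrite !inE eqxx orbT.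
    rewrite cardsCs finset.setCK !cardsU1 !inE negb_or kl kS0 lS0 card_ord S0a /=.
    by rewrite !addnA subnDA.
  transitivity (\sum_(k < d) \sum_(l < d | k != l)
      ('C(d - 2, a) * 'C(d - 2 - a, b)))%N.
    apply: eq_bigr => k _; apply: eq_bigr => l kl.
    transitivity (\sum_(S0 : {set 'I_d} | (S0 \subset ~: [set k; l])%SET
        && (#|S0| == a)) 'C(d - 2 - a, b))%N.
      apply: eq_bigr => S0 /andP[S0U /eqP S0a].
      by rewrite sum1dep_card cards_draws cardC3.
    by rewrite sum_nat_cond_const cards_draws cardC2.
  transitivity (\sum_(k < d) (d.-1 * ('C(d - 2, a) * 'C(d - 2 - a, b))))%N;
    last by rewrite sum_nat_const card_ord.
  apply: eq_bigr => k _.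
  rewrite sum_nat_cond_const; congr (_ * _)%N.
  have -> : [set l | k != l]%SET = [set~ k]%SET.
    by apply/setP => l; rewrite !inE eq_sym.
  by rewrite cardsC1 card_ord.
have h1 : ('C(d - 2 - a, b) * (b`! * (d - (a + b + 2))`!) = (d - 2 - a)`!)%N.
  by rewrite (_ : d - (a + b + 2) = d - 2 - a - b)%N ?bin_fact//; lia.
have h2 : ('C(d - 2, a) * (a`! * (d - 2 - a)`!) = (d - 2)`!)%N.
  by rewrite bin_fact//; lia.
have -> : (d`! = d * (d.-1 * (d - 2)`!))%N.
  by case: d abd {h1 h2} => [|[|e]] abd; [lia|lia|rewrite !factS !subSS subn0].
by rewrite -h2 -h1; ring.
Qed.

(** * Configurations realised by a family of reals *)

Section cells.
Context {R : realDomainType} (d : nat).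
Implicit Types (x : 'I_d -> R) (q : config d).

(** Written in terms of the pair [z] and one further value [u], so that it supplies the constraint
    sets of [law_pair], whose sections at [z] are half-lines or an interval. *)
Definition cell (S0 S1 : {set 'I_d}) (m : 'I_d) (z : R * R) (u : R) : bool :=
  if m \in S0 then u < z.1 else if m \in S1 then z.1 < u < z.2 else z.2 < u.

Definition has_config q x : Prop :=
  let: (k, l, S0, S1) := q in
  x k < x l /\
  forall m, (m != k) && (m != l) -> cell S0 S1 m (x k, x l) (x m).

(** As [x k < x l], the three kinds of cells are disjoint and avoid both [x k] and [x l]. Hence [k],
    [l] and [x] determine [S0] and [S1], and no other value ties with [x k] or [x l]. *)
Lemma has_configE a b k l S0 S1 x : is_config a b (k, l, S0, S1) ->
  has_config (k, l, S0, S1) x ->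
  [/\ S0 = [set m | x m < x k]%SET, S1 = [set m | x k < x m < x l]%SET,
      forall m, x m = x k -> m = k & forall m, x m = x l -> m = l].
Proof.
move=> /and3P[kl /andP[/fintype.subsetP S0s _] /andP[/fintype.subsetP S1s _]].
move=> [xkl hm].
have kS0 : k \notin S0 by apply/negP => /S0s; rewrite !inE eqxx.
have lS0 : l \notin S0 by apply/negP => /S0s; rewrite !inE eqxx orbT.
have kS1 : k \notin S1 by apply/negP => /S1s; rewrite !inE eqxx.
have lS1 : l \notin S1 by apply/negP => /S1s; rewrite !inE eqxx orbT.
have S01 m : m \in S1 -> m \notin S0.
  by move=> /S1s; rewrite !inE !negb_or => /and3P[].
have key m : [/\ (m \in S0) = (x m < x k), (m \in S1) = (x k < x m < x l),
    x m = x k -> m = k & x m = x l -> m = l].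
  have [->|mk] := eqVneq m k.
    rewrite ltxx (negPf kS0) (negPf kS1); split => // e.
    by move: xkl; rewrite e ltxx.
  have [->|ml] := eqVneq m l.
    rewrite ltxx andbF (negPf lS0) (negPf lS1) ltNge (ltW xkl); split => // e.
    by move: xkl; rewrite e ltxx.
  have := hm m; rewrite mk ml /cell => /(_ isT).
  case: ifPn => mS0 /=.
    move=> mlt; rewrite mlt; split => //.
    - rewrite [x k < _]ltNge (ltW mlt) /=.
      by apply/negbTE/negP => /S01; rewrite mS0.
    - by move=> e; move: mlt; rewrite e ltxx.
    - by move=> e; move: mlt; rewrite e ltNge (ltW xkl).
  case: ifPn => mS1 /=.
    move=> /andP[k1 l1]; rewrite k1 l1; split => //.
    - by rewrite ltNge (ltW k1).
    - by move=> e; move: k1; rewrite e ltxx.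
    - by move=> e; move: l1; rewrite e ltxx.
  move=> l1; have k1 := lt_trans xkl l1; rewrite k1; split => //.
  - by rewrite ltNge (ltW k1).
  - by rewrite ltNge (ltW l1).
  - by move=> e; move: k1; rewrite e ltxx.
  - by move=> e; move: l1; rewrite e ltxx.
split => [||m|m].
- by apply/setP => m; rewrite inE; have [] := key m.
- by apply/setP => m; rewrite inE; have [] := key m.
- by have [] := key m.
- by have [] := key m.
Qed.

(** Below [x k] lie the [a] values indexed by [S0]; below [x l] lie these, the [b] values indexed by
    [S1], and [x k] itself, which accounts for the successor in the second rank. *)
Lemma has_config_nth a b k l S0 S1 x : is_config a b (k, l, S0, S1) ->
  has_config (k, l, S0, S1) x ->
  nth 0 (sorted_values x) a = x k /\ nth 0 (sorted_values x) (a + b).+1 = x l.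
Proof.
move=> hq hx; have [e0 e1 ek el] := has_configE hq hx.
move: hq => /and3P[_ /andP[_ /eqP S0a] /andP[S1s /eqP S1b]]; have [xkl _] := hx.
split; apply: nth_sorted_values; first by rewrite -e0.
have -> : [set m | x m < x l]%SET = (k |: (S0 :|: S1))%SET.
  apply/setP => m; rewrite e0 e1 !inE; have [->|mk] := eqVneq m k.
    by rewrite xkl.
  have mk' : x m != x k by apply: contraNneq mk => /ek ->.
  by case: (ltgtP (x m) (x k)) mk' => //= mk' _; rewrite (lt_trans mk' xkl).
rewrite cardsU1 cardsU S0a S1b.
have -> : (S0 :&: S1)%SET = finset.set0.
  apply/setP => m; rewrite e0 e1 !inE; apply/negbTE/negP => /and3P[mk km _].
  by move: mk; rewrite ltNge (ltW km).
by rewrite cards0 subn0 e0 e1 !inE !ltxx.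
Qed.

(** The values at [k] and [l] are fixed entries of the sorted sequence and have no ties, which fixes
    [k] and [l], and then the two sets. This makes the events of distinct configurations
    disjoint. *)
Lemma has_config_uniq a b q q' x : is_config a b q -> is_config a b q' ->
  has_config q x -> has_config q' x -> q = q'.
Proof.
move: q q' => [[[k l] S0] S1] [[[k' l'] S0'] S1'] hq hq' hx hx'.
have [nk nl] := has_config_nth hq hx; have [nk' nl'] := has_config_nth hq' hx'.
have [-> -> ek el] := has_configE hq hx.
have [-> -> _ _] := has_configE hq' hx'.
have -> : k' = k by apply: ek; rewrite -nk -nk'.
by have -> : l' = l by apply: el; rewrite -nl -nl'.
Qed.

Lemma exists_config a b x : injective x -> ((a + b).+1 < d)%N ->
  exists q, is_config a b q /\ has_config q x.
Proof.
move=> xinj abd.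
have [|k nk ck] := nth_sorted_values_inj (i := a) xinj; first by lia.
have [|l nl cl] := nth_sorted_values_inj (i := (a + b).+1) xinj; first by lia.
have xkl : x k < x l.
  (* Otherwise the values below [x l], which number [a + b + 1], would be among the [a] values below
     [x k]. *)
  rewrite ltNge; apply/negP => lk.
  have : (#|[set m | (x m < x l)%R]%SET| <= #|[set m | (x m < x k)%R]%SET|)%N.
    apply: subset_leq_card; apply/fintype.subsetP => m; rewrite !inE => ml.
    exact: lt_le_trans lk.
  by rewrite ck cl; lia.
have kl : k != l by apply: contraTneq xkl => ->; rewrite ltxx.
pose S0 := [set m | x m < x k]%SET; pose S1 := [set m | x k < x m < x l]%SET.
exists (k, l, S0, S1); split.
  apply/and3P; split => //; apply/andP; split.
  - apply/fintype.subsetP => m; rewrite !inE negb_or => mk.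
    by rewrite !(contraTneq _ mk) => [|->|->]; rewrite ?ltxx// ltNge (ltW xkl).
  - by rewrite ck.
  - apply/fintype.subsetP => m; rewrite !inE !negb_or => /andP[km ml].
    rewrite -leNgt (ltW km) andbT; apply/andP; split.
      by apply: contraTneq km => ->; rewrite ltxx.
    by apply: contraTneq ml => ->; rewrite ltxx.
  (* The size of [S1] comes by cancellation in [1 + a + #|S1| = a + b + 1], the count of the values
     below [x l]. *)
  - have e : [set m | x m < x l]%SET = (k |: (S0 :|: S1))%SET.
      apply/setP => m; rewrite !inE; have [->|mk] := eqVneq m k.
        by rewrite xkl.
      have mk' : x m != x k by apply: contraNneq mk => /xinj ->.
      by case: (ltgtP (x m) (x k)) mk' => //= mk' _; rewrite (lt_trans mk' xkl).
    move: cl; rewrite e cardsU1 cardsU ck.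
    have -> : (S0 :&: S1)%SET = finset.set0.
      apply/setP => m; rewrite !inE; apply/negbTE/negP => /and3P[mk km _].
      by move: mk; rewrite ltNge (ltW km).
    have -> : k \notin (S0 :|: S1)%SET by rewrite !inE !ltxx.
    by rewrite cards0 subn0 => /eqP; rewrite add1n eqSS eqn_add2l.
split=> // m /andP[mk ml]; rewrite /cell !inE /=.
have mk' : x m != x k by apply: contraNneq mk => /xinj ->.
have ml' : x m != x l by apply: contraNneq ml => /xinj ->.
by case: (ltgtP (x m) (x k)) mk' => //= mk' _; case: (ltgtP (x m) (x l)) ml'.
Qed.

End cells.

(** * The joint density *)

Section order_statistics.
Context {R : realType} disp (T : measurableType disp) (P : probability T R).
Context (d : nat) (X : 'I_d -> {RV P >-> R}) (f : \bar R -> R).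
Hypotheses (hindep : mutually_independent X)
  (hf : forall k : 'I_d, is_density (X k) f).

Let values t : 'I_d -> R := fun m => X m t.

(** There are finitely many pairs of distinct indices, and for each of them a tie means that the
    pair lies on the diagonal, which the product law does not charge. *)
Lemma ae_injective : {ae P, forall t, injective (values t)}.
Proof.
have h (p : 'I_d * 'I_d) :
    {ae P, forall t, values t p.1 = values t p.2 -> p.1 = p.2}.
  have [->|kl] := eqVneq p.1 p.2; first exact: aeW.
  exists [set t | X p.1 t = X p.2 t].
  have mW : measurable_fun setT (fun t => (X p.1 t, X p.2 t)).
    exact/measurable_fun_pair.
  split.
  - have := mW measurableT _ (@measurable_diag R).
    by rewrite setTI.
  (* With full constraint sets, [law_pair] says that the law of the pair is the product law. *)
  - have := law_pair (B := fun=> setT) hindep kl (fun=> measurableT)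
      measurable_diag.
    rewrite bigcapT// setTI => ->.
    rewrite (eq_integral (cst 1%E)); last first.
      move=> z _; rewrite big1// => m _.
      rewrite (_ : xsection _ _ = setT) ?probability_setT//.
      by apply/seteqP; split => y // _; rewrite /xsection/= inE.
    by rewrite integral_cst ?mul1e//; [exact: product_distribution_diag|
      exact: measurable_diag].
  - by move=> t /not_implyP[].
have : {ae P, forall t (p : 'I_d * 'I_d),
    values t p.1 = values t p.2 -> p.1 = p.2}.
  exact: filter_forall.
by apply: filterS => t ht m m' e; exact: (ht (m, m')).
Qed.

End order_statistics.

Lemma order_density_ge0 (R : realType) (d : nat) (F f : \bar R -> R) i j x y :
  {homo F : x y / (x <= y)%E >-> x <= y} -> (forall x, 0 <= F x <= 1) ->
  (forall x, 0 <= f x) -> 0 <= order_density d F f i j x y.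
Proof.
move=> Fle F01 f0; rewrite /order_density; case: ifPn => // xy.
have /andP[Fx0 _] := F01 x; have /andP[_ Fy1] := F01 y.
by rewrite !mulr_ge0 ?exprn_ge0 ?invr_ge0// subr_ge0// Fle.
Qed.

(** The indices other than [k] and [l] split into [S0], [S1] and a remainder, so only the
    cardinalities matter. This is why all configurations contribute equally. *)
Lemma prod_config (R : comNzRingType) d a b (k l : 'I_d) (S0 S1 : {set 'I_d})
    (u v w : R) : is_config a b (k, l, S0, S1) ->
  \prod_(m | (m != k) && (m != l))
    (if m \in S0 then u else if m \in S1 then v else w) =
  u ^+ a * v ^+ b * w ^+ (d - (a + b + 2)).
Proof.
move=> /and3P[kl /andP[S0s /eqP S0a] /andP[S1s /eqP S1b]].
move: S0s S1s => /fintype.subsetP S0s /fintype.subsetP S1s.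
have kS0 : k \notin S0 by apply/negP => /S0s; rewrite !inE eqxx.
have lS0 : l \notin S0 by apply/negP => /S0s; rewrite !inE eqxx orbT.
have kS1 : k \notin S1 by apply/negP => /S1s; rewrite !inE eqxx.
have lS1 : l \notin S1 by apply/negP => /S1s; rewrite !inE eqxx orbT.
have S01 m : m \in S1 -> m \notin S0.
  by move=> /S1s; rewrite !inE !negb_or => /and3P[].
have memS (S : {set 'I_d}) m : k \notin S -> l \notin S -> m \in S ->
    (m != k) && (m != l).
  move=> kS lS mS.
  by rewrite (contraNneq _ kS) ?(contraNneq _ lS)// => <-.
pose S2 := (~: (k |: (l |: (S0 :|: S1))))%SET.
have S2c : #|S2| = (d - (a + b + 2))%N.
  rewrite cardsCs finset.setCK !cardsU1 !inE !negb_or kl kS0 kS1 lS0 lS1.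
  rewrite cardsU S0a S1b (_ : S0 :&: S1 = finset.set0)%SET.
    by rewrite cards0 card_ord /= subn0; congr (_ - _)%N; lia.
  apply/setP => m; rewrite !inE; apply/negbTE/negP => /andP[m0 /S01].
  by rewrite m0.
rewrite (bigID (mem S0))/= -mulrA; congr (_ * _).
  rewrite (eq_big (mem S0) (fun=> u)) ?prodr_const ?S0a//.
    by move=> m /=; case: (boolP (m \in S0)) => [/memS->//|]; rewrite andbF.
  by move=> m /andP[_ ->].
rewrite (bigID (mem S1))/=; congr (_ * _).
  rewrite (eq_big (mem S1) (fun=> v)) ?prodr_const ?S1b//.
    move=> m /=; case: (boolP (m \in S1)) => [mS|]; rewrite ?andbF//.
    by rewrite (memS S1)// S01.
  by move=> m /andP[/andP[_ /negPf ->] ->].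
rewrite (eq_big (mem S2) (fun=> w)) ?prodr_const ?S2c//.
  by move=> m /=; rewrite !inE !negb_or -!andbA.
by move=> m /andP[/andP[_ /negPf ->] /negPf ->].
Qed.

Section joint_density.
Context {R : realType} disp (T : measurableType disp) (P : probability T R).
Context (d : nat) (X : 'I_d -> {RV P >-> R}) (F f : \bar R -> R).
Hypotheses (hindep : mutually_independent X)
  (hF : forall k : 'I_d, is_distribution_function (X k) F)
  (hf : forall k : 'I_d, is_density (X k) f).

Let values t : 'I_d -> R := fun m => X m t.

(** The order density without its constant and the two factors [f], in the parameters [a = i - 1]
    and [b = j - i - 1], for which [a + b + 2 = j]. *)
Let core a b (z : R * R) : R :=
  F z.1%:E ^+ a * (F z.2%:E - F z.1%:E) ^+ b
  * (1 - F z.2%:E) ^+ (d - (a + b + 2)).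

Let measurable_lt : measurable [set z : R * R | z.1 < z.2].
Proof.
apply: measurable_pred.
exact: (measurable_fun_ltr measurable_fst measurable_snd).
Qed.

Let measurable_F1 : (0 < d)%N ->
  measurable_fun setT (fun z : R * R => F z.1%:E).
Proof.
move=> d0; pose k : 'I_d := Ordinal d0.
exact: (measurableT_comp (measurable_distribution_function (hF k))
  measurable_fst).
Qed.

Let measurable_F2 : (0 < d)%N ->
  measurable_fun setT (fun z : R * R => F z.2%:E).
Proof.
move=> d0; pose k : 'I_d := Ordinal d0.
exact: (measurableT_comp (measurable_distribution_function (hF k))
  measurable_snd).
Qed.

Let measurable_core a b : (0 < d)%N -> measurable_fun setT (core a b).
Proof.
move=> d0; apply: measurable_funM; first apply: measurable_funM.
- by apply: measurable_funX; exact: measurable_F1.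
- apply: measurable_funX; apply: measurable_funB.
    exact: measurable_F2.
  exact: measurable_F1.
- apply: measurable_funX; apply: measurable_funB => //.
  exact: measurable_F2.
Qed.

Let measurable_integrand a b : (0 < d)%N ->
  measurable_fun setT (fun z : R * R => core a b z * f z.1%:E * f z.2%:E).
Proof.
move=> d0; have [_ mf _] := hf (Ordinal d0).
apply: measurable_funM; first apply: measurable_funM.
- exact: measurable_core.
- exact: (measurableT_comp mf measurable_fst).
- exact: (measurableT_comp mf measurable_snd).
Qed.

Let core_ge0 a b z : (0 < d)%N -> z.1 < z.2 -> 0 <= core a b z.
Proof.
move=> d0 z12; pose k : 'I_d := Ordinal d0.
rewrite !mulr_ge0// exprn_ge0//.
- exact: (distribution_function_ge0 (hF k)).
- rewrite subr_ge0; apply: (distribution_function_le (hF k)).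
  by rewrite lee_fin ltW.
- by rewrite subr_ge0; exact: (distribution_function_le1 (hF k)).
Qed.

Let config_event (A : set (R * R)) (q : config d) : set T :=
  let: (k, l, S0, S1) := q in
  [set t | A (X k t, X l t) /\ has_config q (values t)].

Let B (S0 S1 : {set 'I_d}) m : set (R * R * R) :=
  [set zu | cell S0 S1 m zu.1 zu.2].

Let measurable_B S0 S1 m : measurable (B S0 S1 m).
Proof.
have m1 : measurable_fun setT (fun zu : R * R * R => zu.1.1).
  exact: (measurableT_comp measurable_fst measurable_fst).
have m2 : measurable_fun setT (fun zu : R * R * R => zu.1.2).
  exact: (measurableT_comp measurable_snd measurable_fst).
have m3 : measurable_fun setT (fun zu : R * R * R => zu.2).
  exact: measurable_snd.
apply: measurable_pred; rewrite /cell; case: (m \in S0) => //.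
  exact: measurable_fun_ltr.
case: (m \in S1); last exact: measurable_fun_ltr.
by apply: measurable_and; exact: measurable_fun_ltr.
Qed.

(** The form that [law_pair] accepts: the condition [x k < x l] joins [A] as a constraint on the
    pair alone. *)
Let config_eventE A k l S0 S1 : config_event A (k, l, S0, S1) =
  \bigcap_(m in [set m | (m != k) && (m != l)])
    [set t | B S0 S1 m (X k t, X l t, X m t)]
  `&` [set t | (A `&` [set z | z.1 < z.2]) (X k t, X l t)].
Proof.
apply/seteqP; split => t /=; first by move=> [? [? h]]; split.
by move=> [h [? ?]].
Qed.

Let measurable_pairX k l : measurable_fun setT (fun t => (X k t, X l t)).
Proof. exact/measurable_fun_pair. Qed.

Let measurable_config_event A q : measurable A -> measurable (config_event A q).
Proof.
move: q => [[[k l] S0] S1] mA; rewrite config_eventE; apply: measurableI.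
  apply: fin_bigcap_measurable => [|m _]; first exact: finite_finset.
  have mm : measurable_fun setT (fun t => ((X k t, X l t), X m t)).
    by apply: measurable_fun_pair => //; exact: measurable_pairX.
  by rewrite -[X in measurable X]setTI; exact: mm.
rewrite -[X in measurable X]setTI; apply: measurable_pairX => //.
exact: measurableI.
Qed.

(** Given that the pair equals [z], each other variable contributes a factor [F z.1],
    [F z.2 - F z.1] or [1 - F z.2] according to its cell, and [prod_config] collects them into
    powers. *)
Lemma law_config_event A a b q : (0 < d)%N -> measurable A -> is_config a b q ->
  P (config_event A q) =
  (\int[lebR \x lebR]_(z in A `&` [set z | (z.1 < z.2)%R])
     (core a b z * f z.1%:E * f z.2%:E)%:E)%E.
Proof.
move: q => [[[k l] S0] S1] d0 mA hq; rewrite config_eventE.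
have kl : k != l by have /and3P[] := hq.
have mC : measurable (A `&` [set z | z.1 < z.2]) by exact: measurableI.
rewrite law_pair// -(ge0_integral_pair_density (hf k) (hf l))//; last 2 first.
- exact: measurable_core.
- by move=> z [_ z12]; exact: core_ge0.
apply: eq_integral => z /set_mem[_ z12].
rewrite /core -(prod_config _ _ _ hq) -prodEFin; apply: eq_bigr => m _.
rewrite (_ : xsection _ _ = [set u | cell S0 S1 m z u]); last first.
  by apply/seteqP; split => u; rewrite /xsection/= inE.
rewrite /cell; case: (m \in S0); first exact: distribution_lt.
case: (m \in S1); first exact: distribution_between.
exact: distribution_gt.
Qed.

(** The event is, up to ties, the disjoint union of the events of the configurations, which are
    equally likely; their number is the constant. *)
Lemma law_order_statistics A a b : (a + b + 2 <= d)%N -> measurable A ->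
  P [set t | A (order_statistic X a.+1 t, order_statistic X (a + b).+2 t)] =
  (\int[lebR \x lebR]_(z in A `&` [set z | (z.1 < z.2)%R])
     ((d`!%:R / (a`! * b`! * (d - (a + b + 2))`!)%:R)
      * core a b z * f z.1%:E * f z.2%:E)%:E)%E.
Proof.
move=> abd mA; have d0 : (0 < d)%N by lia.
pose Q := [set q : config d | is_config a b q]%SET.
pose E := \bigcup_(q in [set` enum Q]) config_event A q.
set G := [set t | _].
have mG : measurable G.
  have m1 : measurable_fun setT (order_statistic X a.+1).
    by apply: measurable_order_statistic; lia.
  have m2 : measurable_fun setT (order_statistic X (a + b).+2).
    by apply: measurable_order_statistic; lia.
  rewrite -[X in measurable X]setTI.
  exact: (measurable_fun_pair m1 m2).
have mE : measurable E.
  by apply: fin_bigcup_measurable => // q _; exact: measurable_config_event.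
have EG : E `<=` G.
  move=> t [q /=]; rewrite mem_enum inE; move: q => [[[k l] S0] S1] hq [At ht].
  rewrite /G /= /order_statistic -/(sorted_values (values t)).
  by have [-> ->] := has_config_nth hq ht.
have [N [mN N0 hN]] := ae_injective hindep hf.
(* [N] covers the ties. Outside it a configuration exists, so [G] lies between [E] and [E] enlarged
   by a null set. *)
have GE : G `<=` E `|` N.
  move=> t Gt; have [tN|tN] := pselect (N t); [by right|left].
  have vinj : injective (values t).
    by apply: contrapT => h; apply: tN; exact: hN.
  have [|q [hq ht]] := exists_config (a := a) (b := b) vinj; first by lia.
  exists q; first by rewrite /= mem_enum inE.
  move: q hq ht => [[[k l] S0] S1] hq ht; split => //.
  move: Gt; rewrite /G /= /order_statistic -/(sorted_values (values t)).
  by have [-> ->] := has_config_nth hq ht.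
have -> : P G = P E.
  apply/eqP; rewrite eq_le; apply/andP; split; last by rewrite le_measure ?inE.
  rewrite -(measureU0 mE mN N0) le_measure ?inE//; exact: measurableU.
rewrite /E measure_fin_bigcup//; last 2 first.
- move=> q q' /=; rewrite !mem_enum !inE => hq hq' [t []].
  case: q q' hq hq' => [[[k l] S0] S1] [[[k' l'] S0'] S1'] hq hq'.
  by move=> [_ ht] [_ ht']; exact: has_config_uniq hq hq' ht ht'.
- by move=> q _; exact: measurable_config_event.
rewrite -fsbig_seq ?enum_uniq// big_enum/=.
rewrite (eq_bigr (fun=> (\int[lebR \x lebR]_(z in A `&` [set z | (z.1 < z.2)%R])
     (core a b z * f z.1%:E * f z.2%:E)%:E)%E)); last first.
  by move=> q; rewrite inE => hq; exact: law_config_event.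
rewrite sumr_const.
set I := (\int[_]_(z in _) _)%E.
transitivity ((#|Q|%:R : R)%:E * I)%E; first by rewrite mule_natl.
have cQ : d`!%:R / (a`! * b`! * (d - (a + b + 2))`!)%:R = #|Q|%:R :> R.
  rewrite -(card_config abd) natrM mulfK//.
rewrite cQ -ge0_integralZl//.
- by apply: eq_integral => z _; rewrite -EFinM !mulrA.
- exact: measurableI.
- apply/measurable_EFinP; apply: measurable_funTS.
  exact: measurable_integrand.
- move=> z [_ /= z12]; rewrite lee_fin.
  have [f0 _ _] := hf (Ordinal d0).
  by apply: mulr_ge0 => //; apply: mulr_ge0 => //; exact: core_ge0.
Qed.

Lemma joint_density_order_statistics i j : (1 <= i)%N -> (i < j <= d)%N ->
  is_joint_density P (order_statistic X i) (order_statistic X j)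
    (order_density d F f i j).
Proof.
move=> i1 /andP[ij jd]; have d0 : (0 < d)%N by lia.
pose k0 : 'I_d := Ordinal d0.
have F01 x : 0 <= F x <= 1.
  by rewrite (distribution_function_ge0 (hF k0))
    (distribution_function_le1 (hF k0)).
have [f0 _ _] := hf k0.
have g0 x y : 0 <= order_density d F f i j x y.
  by apply: order_density_ge0 => //; exact: (distribution_function_le (hF k0)).
pose a := (i - 1)%N; pose b := (j - i - 1)%N.
have dj : (d - j = d - (a + b + 2))%N by rewrite /a /b; lia.
pose K : R := d`!%:R / (a`! * b`! * (d - (a + b + 2))`!)%:R.
have gE (z : R * R) : order_density d F f i j z.1%:E z.2%:E =
    if z.1 <= z.2 then K * core a b z * f z.1%:E * f z.2%:E else 0.
  by rewrite /order_density lee_fin dj /core /K /a /b !mulrA.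
have mg : measurable_fun setT
    (fun z : R * R => order_density d F f i j z.1%:E z.2%:E).
  apply: (eq_measurable_fun (fun z : R * R =>
    if z.1 <= z.2 then K * core a b z * f z.1%:E * f z.2%:E else 0)) => [z _|].
    by rewrite gE.
  apply: measurable_fun_ifT => //.
    exact: (measurable_fun_ler measurable_fst measurable_snd).
  have := measurable_integrand a b d0 => m1.
  rewrite (_ : (fun _ => _) = (fun z : R * R =>
    K * (core a b z * f z.1%:E * f z.2%:E))).
    exact: measurable_funM.
  by apply/funext => z; rewrite !mulrA.
split => //.
- by split; apply: measurable_order_statistic; lia.
move=> A mA.
rewrite ge0_integral_lebR2//; last 2 first.
- by apply: measurable_funTS; exact/measurable_EFinP.
- by move=> z _; rewrite lee_fin.
have ia : i = a.+1 by rewrite /a; lia.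
have jb : j = (a + b).+2 by rewrite /a /b; lia.
have abd : (a + b + 2 <= d)%N by rewrite /a /b; lia.
have := law_order_statistics abd mA; rewrite -ia -jb.
rewrite (_ : _ @^-1` A = [set t | A (order_statistic X i t, order_statistic X j t)])//.
(* Removing the null diagonal from the domain turns the support [x <= y] of the density into the
   [x < y] of the law. *)
move=> ->; rewrite [RHS](ge0_negligible_integral measurable_diag)//; last 3 first.
- by apply: measurable_funTS; exact/measurable_EFinP.
- by move=> z _; rewrite lee_fin.
- exact: lebR2_diag.
rewrite [LHS]integral_mkcond [RHS]integral_mkcond.
apply: eq_integral => z _.
rewrite !patchE setDE !in_setI; case: (z \in A) => //=.
have -> : (z \in [set z0 : R * R | z0.1 < z0.2]) = (z.1 < z.2).
  by apply/idP/idP; rewrite inE.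
have -> : (z \in ~` [set z0 : R * R | z0.1 = z0.2]) = (z.1 != z.2).
  by apply/idP/idP => [/set_mem/= /eqP//|/eqP h]; exact: mem_set.
by rewrite gE; case: ltgtP.
Qed.

End joint_density.

(** The image of [m \x m] under the exchange of coordinates agrees with [m \x m] on rectangles, so
    it is the same measure. *)
Lemma ge0_integral_swap d (T : measurableType d) (R : realType)
    (m : {sigma_finite_measure set T -> \bar R}) (A : set (T * T))
    (h : T * T -> \bar R) :
  measurable A -> measurable_fun setT h -> (forall u, 0 <= h u)%E ->
  (\int[m \x m]_(u in (fun u => (u.2, u.1)) @^-1` A) h (u.2, u.1) =
   \int[m \x m]_(u in A) h u)%E.
Proof.
move=> mA mh h0; pose sw (u : T * T) := (u.2, u.1).
have msw : measurable_fun setT sw.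
  by apply: measurable_fun_pair; [exact: measurable_snd|exact: measurable_fst].
pose nu' : {measure set _ -> \bar R} := pushforward (m \x m)%E sw.
pose nu := nu' msw.
rewrite [RHS](eq_measure_integral nu).
  by rewrite [RHS]ge0_integral_pushforward//; exact: measurable_funTS.
move=> B mB _.
apply: (@product_measure_unique _ _ _ _ _ m m nu) => // C D mC mD.
rewrite muleC -product_measure1E//=; congr (product_measure1 _ _ _).
by apply/seteqP; split => -[x y] /= [].
Qed.

(** Reduces the case [i > j] to that of the pair in increasing order of rank. *)
Lemma is_joint_density_swap (R : realType) disp (T : measurableType disp)
    (P : probability T R) (Y Z : T -> R) (g : \bar R -> \bar R -> R) :
  is_joint_density P Y Z g -> is_joint_density P Z Y (fun x y => g y x).
Proof.
move=> [[mY mZ] g0 mg gE].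
have msw : measurable_fun setT (fun u : R * R => (u.2, u.1)).
  by apply: measurable_fun_pair; [exact: measurable_snd|exact: measurable_fst].
have mg' : measurable_fun setT (fun u : R * R => g u.2%:E u.1%:E).
  exact: (measurableT_comp mg msw).
split => // A mA.
have mA' : measurable ((fun u : R * R => (u.2, u.1)) @^-1` A).
  by rewrite -[X in measurable X]setTI; exact: msw.
have := gE _ mA'.
rewrite (_ : _ @^-1` _ = (fun t => (Z t, Y t)) @^-1` A)// => ->.
rewrite !ge0_integral_lebR2//.
- apply: (ge0_integral_swap lebR (h := fun u => (g u.2%:E u.1%:E)%:E)) => //.
    exact/measurable_EFinP.
  by move=> u; rewrite lee_fin.
- by apply: measurable_funTS; exact/measurable_EFinP.
- by move=> u _; rewrite lee_fin.
- by apply: measurable_funTS; exact/measurable_EFinP.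
- by move=> u _; rewrite lee_fin.
Qed.

(** * Total positivity *)

Lemma TP2_order_density (R : realType) (d : nat) (F f : \bar R -> R) i j :
  {homo F : x y / (x <= y)%E >-> x <= y} -> (forall x, 0 <= F x <= 1) ->
  (forall x, 0 <= f x) -> TP2 (order_density d F f i j).
Proof.
move=> Fle F01 f0; split=> [x y|x x' y y' xx' yy'].
  exact: order_density_ge0.
(* If [y < x'], the factor at [(x', y)] is 0 and nonnegativity suffices. Otherwise
   [x <= x' <= y <= y'], and all four points lie in the support. *)
have [x'y|x'y] := leP x' y; last first.
  rewrite [X in X * _](_ : _ = 0); last by rewrite /order_density leNgt x'y.
  by rewrite mul0r mulr_ge0 ?order_density_ge0.
rewrite /order_density x'y (le_trans x'y yy') (le_trans xx' x'y).
rewrite (le_trans xx' (le_trans x'y yy')).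
have /andP[Fx0 _] := F01 x; have /andP[Fx'0 _] := F01 x'.
have /andP[_ Fy1] := F01 y; have /andP[_ Fy'1] := F01 y'.
have Fxx' := Fle _ _ xx'; have Fx'y := Fle _ _ x'y; have Fyy' := Fle _ _ yy'.
set K := _ / _; have K0 : 0 <= K by rewrite divr_ge0.
(* By the identity for the differences of [F], the bases are ordered; they are nonnegative, so their
   powers are ordered too. *)
have cross : ((F y - F x') * (F y' - F x)) ^+ (j - i - 1) <=
    ((F y' - F x') * (F y - F x)) ^+ (j - i - 1).
  by apply: lerXn2r; rewrite ?nnegrE; nra.
rewrite !exprMn in cross.
(* All the factors other than the powers of differences of [F] have the same product on both sides,
   and it is nonnegative. *)
have w0 : 0 <= K * F x ^+ (i - 1) * (1 - F y) ^+ (d - j) * f x * f y *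
    (K * F x' ^+ (i - 1) * (1 - F y') ^+ (d - j) * f x' * f y').
  by rewrite !mulr_ge0 ?exprn_ge0 ?subr_ge0.
have := ler_wpM2l w0 cross; congr (_ <= _); ring.
Qed.

Lemma TP2_swap (R : realType) (g : \bar R -> \bar R -> R) :
  TP2 g -> TP2 (fun x y => g y x).
Proof.
move=> [g0 gTP]; split => // x x' y y' xx' yy'.
by rewrite [leLHS]mulrC; exact: gTP.
Qed.

Theorem proposition12 (R : realType) (disp : measure_display)
    (T : measurableType disp) (P : probability T R) (d : nat) (hd : (2 <= d)%N)
    (X : 'I_d -> {RV P >-> R}) (F f : \bar R -> R)
    (hindep : mutually_independent X)
    (hident : identically_distributed X)
    (hF : forall k : 'I_d, is_distribution_function (X k) F)
    (hf : forall k : 'I_d, is_density (X k) f)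
    (i j : nat) (hi : (1 <= i <= d)%N) (hj : (1 <= j <= d)%N) (hij : i <> j) :
  PLRD P (order_statistic X i) (order_statistic X j)
    (order_pair_density d F f i j).
Proof.
have d0 : (0 < d)%N by lia.
pose k0 : 'I_d := Ordinal d0.
have Fle := distribution_function_le (hF k0).
have F01 x : 0 <= F x <= 1.
  by rewrite (distribution_function_ge0 (hF k0))
    (distribution_function_le1 (hF k0)).
have [f0 _ _] := hf k0.
(* In the second case [i <> j] forces [j < i], and both properties are transported by exchanging the
   arguments. *)
rewrite /order_pair_density; case: ltnP => ij; split.
- by apply: joint_density_order_statistics => //; lia.
- exact: TP2_order_density.
- by apply/is_joint_density_swap/joint_density_order_statistics => //; lia.
- by apply/TP2_swap/TP2_order_density.
Qed.
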